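(* Let $R$ be a finite $*$-ring. Then $\operatorname{gr}(\Gamma'(R))$ is $3$ or $4$ or $\infty$.
   Context: A $*$-ring is a ring $R$ with a map $*:R\to R$ (an involution) satisfying $(x+y)^*=x^*+y^*$, $(xy)^*=y^*x^*$ and $(x^* )^*=x$ for all $x,y\in R$. $Z^*(R)$ denotes the set of all non-zero zero-divisors of $R$ (left or right). The generalized zero-divisor graph $\Gamma'(R)$ is the simple undirected graph with vertex set $Z^*(R)$ in which two distinct vertices $x,y$ are adjacent if and only if $x^ny^*=0$ or $y^nx^*=0$ for some positive integer $n$. The girth $\operatorname{gr}(G)$ is the length of a shortest cycle in $G$, and is $\infty$ if $G$ has no cycle. *)

(* Defs.v *)
From HB Require Import structures.
From mathcomp Require Import all_boot all_order all_algebra.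
From mathcomp Require Import boolp.

Set Implicit Arguments.
Unset Strict Implicit.
Unset Printing Implicit Defensive.

Import GRing.Theory.
Local Open Scope ring_scope.

Declare Scope rng_scope.
Delimit Scope rng_scope with rng.

(* Rings here are associative, not necessarily commutative and not necessarily
   unital; MathComp's own ring structures all have a unit. *)
HB.mixin Record Zmodule_isRng R of GRing.Zmodule R := {
  rngmul : R -> R -> R;
  rngmulA : associative rngmul;
  rngmulDl : left_distributive rngmul +%R;
  rngmulDr : right_distributive rngmul +%R
}.

#[short(type="rngType")]
HB.structure Definition Rng := {R of Zmodule_isRng R & GRing.Zmodule R}.

Notation "x * y" := (rngmul x y) : rng_scope.

HB.mixin Record Rng_isStarRng R of Rng R := {
  star : R -> R;
  starD : {morph star : x y / x + y};
  starM : forall x y, star (rngmul x y) = rngmul (star y) (star x);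
  starK : involutive star
}.

#[short(type="starRngType")]
HB.structure Definition StarRng := {R of Rng_isStarRng R & Rng R}.

#[short(type="finStarRngType")]
HB.structure Definition FinStarRng := {R of StarRng R & Finite R}.

Notation "x ^*" := (star x) : rng_scope.

(* Meaningful for n > 0 only: the value 0 at n = 0 is arbitrary, since there
   need not be a unit. *)
Definition rngexp (R : rngType) (x : R) (n : nat) : R :=
  iterop n (@rngmul R) x 0.

Notation "x ^+ n" := (rngexp x n) : rng_scope.

Definition nz_zero_divisor (R : rngType) (x : R) : Prop :=
  x <> 0 /\ exists y : R, y <> 0 /\ ((x * y)%rng = 0 \/ (y * x)%rng = 0).

Definition gzd_vertex (R : rngType) : Type :=
  {x : R | `[< nz_zero_divisor x >]}.

Definition gzd_graph (R : starRngType) : rel (gzd_vertex R) :=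
  fun u v => let x := val u in let y := val v in
    `[< u <> v /\ exists n : nat, (0 < n)%N /\
          ((x ^+ n * y ^*)%rng = 0 \/ (y ^+ n * x ^*)%rng = 0) >].

Lemma gzd_graph_irr (R : starRngType) : irreflexive (@gzd_graph R).
Proof. by move=> u; apply/asboolP => -[]. Qed.

Lemma gzd_graph_sym (R : starRngType) : symmetric (@gzd_graph R).
Proof.
suff H u v : gzd_graph u v -> @gzd_graph R v u by move=> u v; apply/idP/idP; apply: H.
move/asboolP => [uv [n [n0 H]]]; apply/asboolP; split; first exact: nesym.
by exists n; split=> //; case: H; [right|left].
Qed.

(* A simple graph is a symmetric irreflexive relation; the lower bound on the
   size excludes the 2-cycles that run back and forth along one edge. *)
Definition has_cycle_of_length (T : eqType) (e : rel T) (k : nat) : Prop :=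
  exists c : seq T, [/\ ucycle e c, (3 <= size c)%N & size c = k].

(* None stands for infinity. *)
Definition girth (T : eqType) (e : rel T) : option nat :=
  match pselect (exists k, `[< has_cycle_of_length e k >]) with
  | left ex => Some (ex_minn ex)
  | right _ => None
  end.

Lemma girth_SomeP (T : eqType) (e : rel T) (g : nat) :
  girth e = Some g <->
  has_cycle_of_length e g /\ forall k, has_cycle_of_length e k -> (g <= k)%N.
Proof.
rewrite /girth; case: pselect => [ex|nex].
  case: ex_minnP => m /asboolP cm min_m; split=> [[<-]|[cg min_g]].
    by split=> // k /asboolP; apply: min_m.
  congr Some; apply/eqP; rewrite eqn_leq min_g // andbT.
  by apply: min_m; apply/asboolP.
by split=> // -[cg _]; case: nex; exists g; apply/asboolP.
Qed.

Lemma girth_NoneP (T : eqType) (e : rel T) :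
  girth e = None <-> forall k, ~ has_cycle_of_length e k.
Proof.
rewrite /girth; case: pselect => [ex|nex]; split=> //.
  by move=> no_cycle; exfalso; case: ex => k /asboolP; apply: no_cycle.
by move=> _ k ck; apply: nex; exists k; apply/asboolP.
Qed.

(* Main.v *)
Require Import Defs.
From mathcomp Require Import all_boot all_order all_algebra.
From mathcomp Require Import boolp.

(** A nonzero [x] with [x * x = 0] is adjacent to every other vertex, so an edge
    avoiding [x] closes up to a triangle.  Otherwise the ring is reduced, and
    adjacency of [x] and [y] just means [x * y^* = 0].  If [a] has two distinct
    neighbours [p] and [q], every nonzero multiple [a * r] is again adjacent to
    [p] and [q]; unless [a * r = a], this gives a triangle or the 4-cycle
    [p, a, q, a * r].  So in the absence of 3- and 4-cycles, all vertices of a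
    cycle generate right ideals [{0, a}], and two of them are nonadjacent only
    if they are exchanged by the involution.  For consecutive [a, b, c, d, e],
    both [a] and [e] are nonadjacent to [c] (there being no triangles), hence
    [a = c^* = e]. *)

Set Implicit Arguments.
Unset Strict Implicit.
Unset Printing Implicit Defensive.

Import GRing.Theory.

Section Cycles.
Variables (T : eqType) (e : rel T).
Hypotheses (e_sym : symmetric e) (e_irr : irreflexive e).

Lemma adj_neq u v : e u v -> u != v.
Proof. by apply: contraTneq => ->; rewrite e_irr. Qed.

Lemma has_cycle3 u v w : e u v -> e v w -> e w u -> has_cycle_of_length e 3.
Proof.
move=> uv vw wu; exists [:: u; v; w]; split=> //.
rewrite /ucycle /= uv vw wu /= !inE negb_or (adj_neq uv) (adj_neq vw).
by rewrite eq_sym (adj_neq wu).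
Qed.

Lemma has_cycle4 u v w z : u != w -> v != z ->
  e u v -> e v w -> e w z -> e z u -> has_cycle_of_length e 4.
Proof.
move=> uw vz uv vw wz zu; exists [:: u; v; w; z]; split=> //.
rewrite /ucycle /= uv vw wz zu /= !inE !negb_or uw vz (adj_neq uv).
by rewrite (adj_neq vw) (adj_neq wz) eq_sym (adj_neq zu).
Qed.

(** Four consecutive vertices of the cycle give disjoint edges [a b] and [c d]; one of them avoids
    [x], and its ends form a triangle with [x]. *)
Lemma dominating_vertex_cycle3 x k : (forall v, x != v -> e x v) ->
  (4 <= k)%N -> has_cycle_of_length e k -> has_cycle_of_length e 3.
Proof.
move=> dom_x k4 [[|a [|b [|c [|d s]]]] [/andP[cyc uniq_c] _ size_c]];
  try by rewrite -size_c in k4.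
have triangle u v : e u v -> x != u -> x != v -> has_cycle_of_length e 3.
  by move=> uv xu xv; apply: (has_cycle3 (dom_x u xu) uv); rewrite e_sym dom_x.
move: cyc uniq_c; rewrite /= !inE !negb_or => /and4P[ab _ cd _].
move=> /and5P[/and4P[_ ac ad _] /and3P[bc bd _] _ _ _].
have [xa|xa] := eqVneq x a; first by apply: (triangle c d) => //; rewrite xa.
have [xb|xb] := eqVneq x b; first by apply: (triangle c d) => //; rewrite xb.
exact: (triangle a b).
Qed.

(** On a short cycle the path overlaps itself: [p = f] and [q = a] when [k = 5]. Hence only selected
    pairs are claimed distinct. *)
Lemma cycle_path5 k : (5 <= k)%N -> has_cycle_of_length e k ->
  exists p a b c d f q,
    [/\ e p a, e a b, e b c & [/\ e c d, e d f & e f q]] /\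
    [/\ p != b, b != d, d != q & [/\ a != c, c != f & a != f]].
Proof.
move=> k5 [[|a [|b [|c [|d [|f s]]]]] [/andP[cyc uniq_c] _ size_c]];
  try by rewrite -size_c in k5.
exists (last f s), a, b, c, d, f, (head a s).
move: cyc uniq_c; rewrite /= => /and5P[-> -> -> -> path_s].
rewrite !inE !negb_or => /and5P[/and5P[_ ac ad af as_]].
move=> /and4P[_ bd bf bs] /and3P[_ cf _] /andP[_ ds] _.
split; split=> //; first by move: path_s; rewrite rcons_path => /andP[].
- by split=> //; case: s path_s {size_c as_ bs ds} => [|g s] /= /andP[].
- apply: contraNneq bs => bE; move: (mem_last f s).
  by rewrite bE inE (negPf bf).
- case: s ds {path_s size_c as_ bs} => [|g s] /=; first by rewrite eq_sym.
  by rewrite inE negb_or => /andP[].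
Qed.

End Cycles.

Section StarRng.
Local Open Scope ring_scope.
Local Open Scope rng_scope.
Variable R : starRngType.
Implicit Types x y z : R.

Lemma rngmul0r x : 0 * x = 0.
Proof. by apply: (addrI (0 * x)); rewrite -rngmulDl !addr0. Qed.

Lemma rngmulr0 x : x * 0 = 0.
Proof. by apply: (addrI (x * 0)); rewrite -rngmulDr !addr0. Qed.

Lemma star0 : (0 : R)^* = 0.
Proof. by apply: (addrI (0 : R)^*); rewrite -starD !addr0. Qed.

Lemma star_eq0 x : x^* = 0 -> x = 0.
Proof. by move=> x0; rewrite -[x]starK x0 star0. Qed.

Lemma sqr0_dominating x : x <> 0 -> x * x = 0 ->
  exists u : gzd_vertex R, forall v, u != v -> gzd_graph u v.
Proof.
move=> x_neq0 xx0.
have x_zd : `[< nz_zero_divisor x >].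
  by apply/asboolP; split=> //; exists x; split=> //; left.
exists (exist _ x x_zd) => v /eqP uv; apply/asboolP; split=> //.
(* With exponent 2 the power of [x] vanishes, whatever [v] is. *)
by exists 2; split=> //; left; rewrite /rngexp /= xx0 rngmul0r.
Qed.

Hypothesis reduced : forall x, x * x = 0 -> x = 0.

Lemma reduced_mulC0 x y : x * y = 0 -> y * x = 0.
Proof.
by move=> xy; apply: reduced; rewrite -rngmulA (rngmulA x) xy rngmul0r rngmulr0.
Qed.

Lemma reduced_insert x y z : x * y = 0 -> x * z * y = 0.
Proof.
move=> /reduced_mulC0 yx; apply: reduced.
by rewrite -!rngmulA (rngmulA y x) yx rngmul0r !rngmulr0.
Qed.

(** Moving one factor [x] to the right of [y] lowers the exponent, so induction yields
    [x * (y * x) = 0], and then [x * y] squares to zero. *)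
Lemma reduced_exp n x y : x ^+ n.+1 * y = 0 -> x * y = 0.
Proof.
elim: n y => [//|n IHn] y.
have -> : x ^+ n.+2 = x * x ^+ n.+1 by [].
rewrite -rngmulA => /reduced_mulC0; rewrite -rngmulA => /IHn xyx.
by apply: reduced; rewrite rngmulA -(rngmulA x) xyx rngmul0r.
Qed.

Lemma orth_sym x y : x * y^* = 0 -> y * x^* = 0.
Proof. by move=> xy; rewrite -[y]starK -starM xy star0. Qed.

Lemma reduced_adjP (u v : gzd_vertex R) :
  reflect (u <> v /\ val u * (val v)^* = 0) (gzd_graph u v).
Proof.
apply: (iffP (asboolP _)) => [[uv [[|n] [//= _ [H|H]]]]|[uv H]]; split=> //.
- exact: reduced_exp H.
- exact/orth_sym/(reduced_exp H).
- by exists 1; split=> //; left.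
Qed.

Let e : rel (gzd_vertex R) := @gzd_graph R.
Let e_sym : symmetric e := @gzd_graph_sym R.
Let e_irr : irreflexive e := @gzd_graph_irr R.

Hypothesis no3 : ~ has_cycle_of_length e 3.
Hypothesis no4 : ~ has_cycle_of_length e 4.

Lemma rideal_trivial p a q : e p a -> e a q -> p != q ->
  forall r, val a * r = 0 \/ val a * r = val a.
Proof.
move=> pa aq pq r.
have [ar0|/eqP ar0] := eqVneq (val a * r) 0; [by left | right].
(* The star of [val a * r] is [r^* * (val a)^*], and [r^*] may be inserted into the zero product
   [val v * (val a)^*]. *)
have orth v : e v a -> val v * (val a * r)^* = 0.
  by move=> /reduced_adjP[_ va]; rewrite starM rngmulA reduced_insert.
have qa : e q a by rewrite e_sym.
have ar_zd : `[< nz_zero_divisor (val a * r) >].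
  apply/asboolP; split=> //; exists (val p)^*; split; last first.
    by left; apply/orth_sym/orth.
  by move=> /star_eq0; case: (asboolP _ (valP p)).
pose w : gzd_vertex R := exist _ (val a * r) ar_zd.
have adj_w v : e v a -> v != w -> e v w.
  by move=> va /eqP vw; apply/reduced_adjP; split=> //; apply: orth.
have [aw|aw] := eqVneq a w; first by rewrite {2}aw.
(* If [p] were [w], it would be adjacent to [q], closing the triangle [p], [a], [q]; the same goes
   for [q]. *)
have pw : p != w.
  apply/eqP => pw; apply: no3; apply: (has_cycle3 e_irr pa aq).
  by rewrite pw adj_w // -pw eq_sym.
have qw : q != w.
  apply/eqP => qw; apply: no3; apply: (has_cycle3 e_irr pa aq).
  by rewrite e_sym qw adj_w // -qw.
case: no4; apply: (has_cycle4 e_irr pq aw pa aq (adj_w q qa qw)).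
by rewrite e_sym adj_w.
Qed.

(** Nonadjacency leaves [u * v^* = u] and [v * u^* = v]; the star of the latter reads
    [u * v^* = v^*]. *)
Lemma nonadj_star u v :
  (forall r, val u * r = 0 \/ val u * r = val u) ->
  (forall r, val v * r = 0 \/ val v * r = val v) ->
  u != v -> ~~ e u v -> val u = (val v)^*.
Proof.
move=> u_min v_min /eqP uv /reduced_adjP nuv.
have [uv0|uE] := u_min (val v)^*; first by case: nuv.
have [vu0|vE] := v_min (val u)^*; first by case: nuv; split=> //; apply: orth_sym.
by rewrite -[LHS]uE -[in RHS]vE starM starK.
Qed.

Lemma reduced_no_long_cycle k : (5 <= k)%N -> ~ has_cycle_of_length e k.
Proof.
move=> k5 /(cycle_path5 k5) [p [a [b [c [d [f [q]]]]]]].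
move=> [[pa ab bc [cd df fq]] [pb bd dq [ac cf /eqP af]]]; apply: af.
have no_chord u v w : e u v -> e v w -> ~~ e u w.
  move=> uv vw; apply/negP => uw; apply: no3.
  by apply: (has_cycle3 e_irr uv vw); rewrite e_sym.
have a_min := rideal_trivial pa ab pb.
have c_min := rideal_trivial bc cd bd.
have f_min := rideal_trivial df fq dq.
apply: val_inj; rewrite (nonadj_star a_min c_min ac (no_chord _ _ _ ab bc)).
by rewrite (nonadj_star f_min c_min) // 1?eq_sym // e_sym (no_chord _ d).
Qed.

End StarRng.

Lemma no_long_girth (R : starRngType) k : (5 <= k)%N ->
  ~ has_cycle_of_length (@gzd_graph R) 3 ->
  ~ has_cycle_of_length (@gzd_graph R) 4 ->
  ~ has_cycle_of_length (@gzd_graph R) k.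
Proof.
move=> k5 no3 no4 cyc; apply: (reduced_no_long_cycle _ no3 no4 k5 cyc) => x xx0.
(* A nonzero [x] of square zero would turn the long cycle into a triangle, so the ring is
   reduced. *)
apply: contrapT => x_neq0; have [u dom_u] := sqr0_dominating x_neq0 xx0.
apply: no3; apply: dominating_vertex_cycle3 dom_u (ltnW k5) cyc.
  exact: gzd_graph_sym.
exact: gzd_graph_irr.
Qed.

Theorem proposition2p14 (R : finStarRngType) :
  girth (@gzd_graph R) = Some 3 \/
  girth (@gzd_graph R) = Some 4 \/
  girth (@gzd_graph R) = None.
Proof.
case gE: (girth (@gzd_graph R)) => [g|]; last by right; right.
have [cyc g_min] := (girth_SomeP _ _).1 gE.
have g3 : (3 <= g)%N by case: cyc => c [_ c3 <-].
have [g5|] := leqP 5 g; last first.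
  by move: g3; case: g {gE cyc g_min} => [|[|[|[|[|g]]]]] // _ _; [left | right; left].
by case: (no_long_girth g5 _ _ cyc) => /g_min; rewrite leqNgt (leq_trans _ g5).
Qed.
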